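(* Let $n\ge1$ and let $\Phi^+$ be the positive root system of type $\widetilde{A}_{n-1}$ realized as $\{\widetilde{e}_j-\widetilde{e}_i : i<j,\ i\not\equiv j \bmod n\}$. The collection of all biclosed subsets of $\Phi^+$, ordered by containment, is a complete lattice. For any collection $\mathcal{X}$ of biclosed sets, $\bigvee\mathcal{X}=\overline{\bigcup_{J\in\mathcal{X}}J}$ and $\bigwedge\mathcal{X}=\big(\bigcap_{J\in\mathcal{X}}J\big)^{\circ}$.
   Context: Let $\widehat V$ be the real vector space spanned by vectors $\widetilde{e}_i$, $i\in\mathbb{Z}$, modulo the relations $\widetilde{e}_{i+n}-\widetilde{e}_i=\widetilde{e}_{j+n}-\widetilde{e}_j$ for all $i,j$. The positive roots are the vectors $\widetilde{e}_j-\widetilde{e}_i$ with $i<j$, $i\not\equiv j\bmod n$ (these correspond to the pairs $(i,j)$ modulo simultaneous translation by $(n,n)$). A subset $J\subseteq\Phi^+$ is closed if whenever $\alpha,\beta\in J$, $\gamma\in\Phi^+$ and $\gamma\in\mathbb{R}_{>0}\alpha+\mathbb{R}_{>0}\beta$, then $\gamma\in J$; coclosed if $\Phi^+\setminus J$ is closed; biclosed if both. The closure $\overline{K}$ of $K\subseteq\Phi^+$ is the intersection of all closed sets containing $K$; the interior $K^\circ$ is the union of all coclosed sets contained in $K$. *)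

(* Defs.v *)
From HB Require Import structures.
From mathcomp Require Import all_boot all_order all_algebra.
From mathcomp Require Import boolp classical_sets reals.
From mathcomp Require Import freeg.

Set Implicit Arguments.
Unset Strict Implicit.
Unset Printing Implicit Defensive.

Import Order.TTheory GRing.Theory Num.Theory.

Local Open Scope ring_scope.
Local Open Scope quotient_scope.
Local Open Scope classical_set_scope.

Section AffineVectorSpace.
Variables (R : realType) (n : nat).

(* [{freeg int / R}] is the free real vector space on the integers. *)
Definition fgen (i : int) : {freeg int / R} := Freeg [:: (1, i)].

Definition relator (p : int * int) : {freeg int / R} :=
  (fgen (p.1 + n%:Z) - fgen p.1) - (fgen (p.2 + n%:Z) - fgen p.2).

(* Linear span of the relators, as finite linear combinations. *)
Definition rel_span : {pred {freeg int / R}} :=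
  [pred v | `[< exists s : seq (R * (int * int)),
                  v = \sum_(c <- s) c.1 *: relator c.2 >]].

Lemma rel_span_submod : submod_closed rel_span.
Proof.
split; first by apply/asboolP; exists [::]; rewrite big_nil.
move=> a u v /asboolP[s ->] /asboolP[t ->]; apply/asboolP.
exists ([seq (a * c.1, c.2) | c <- s] ++ t).
rewrite big_cat big_map scaler_sumr; congr (_ + _).
by apply: eq_bigr => c _; rewrite scalerA.
Qed.

HB.instance Definition _ :=
  GRing.isSubmodClosed.Build R {freeg int / R} rel_span rel_span_submod.

Definition Vhat := Quotient.quot rel_span.

HB.instance Definition _ := EqQuotient.on Vhat.
HB.instance Definition _ := GRing.Zmodule.on Vhat.

Definition Vscale (a : R) := lift_op1 Vhat ( *:%R a).

Lemma pi_Vscale a : {morph \pi_Vhat : x / a *: x >-> Vscale a x}.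
Proof.
move=> x; unlock Vscale; apply/eqP; rewrite piE Quotient.equivE -scalerBr.
by apply: rpredZ; rewrite Quotient.idealrBE reprK.
Qed.

Lemma pi_VhatD : {morph \pi_Vhat : x y / x + y >-> x + y}.
Proof. exact: Quotient.pi_add. Qed.

Lemma VscaleA a b v : Vscale a (Vscale b v) = Vscale (a * b) v.
Proof. by rewrite -[v]reprK -!pi_Vscale scalerA. Qed.

Lemma Vscale1 : left_id 1 Vscale.
Proof. by move=> v; rewrite -[v]reprK -pi_Vscale scale1r. Qed.

Lemma VscaleDr : right_distributive Vscale +%R.
Proof.
by move=> a u v; rewrite -[u]reprK -[v]reprK -pi_VhatD -!pi_Vscale scalerDr pi_VhatD.
Qed.

Lemma VscaleDl v : {morph Vscale^~ v : a b / a + b}.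
Proof. by move=> a b; rewrite -[v]reprK -!pi_Vscale scalerDl pi_VhatD. Qed.

HB.instance Definition _ :=
  GRing.Zmodule_isLmodule.Build R Vhat VscaleA Vscale1 VscaleDr VscaleDl.

Definition etilde (i : int) : Vhat := \pi_Vhat (fgen i).

Definition Phip : set Vhat :=
  [set v | exists i j : int,
     [/\ i < j, (i != j %[mod n%:Z])%Z & v = etilde j - etilde i]].

Implicit Types J K : set Phip.

Definition root_closed J : Prop :=
  forall alpha beta gamma : Phip, J alpha -> J beta ->
    (exists a b : R, [/\ 0 < a, 0 < b &
       val gamma = a *: val alpha + b *: val beta]) ->
    J gamma.

Definition root_coclosed J : Prop := root_closed (~` J).

Definition biclosed J : Prop := root_closed J /\ root_coclosed J.

Definition root_closure K : set Phip := smallest root_closed K.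

Definition root_interior K : set Phip :=
  \bigcup_(J in [set M | root_coclosed M /\ M `<=` K]) J.

Definition biclosed_set : Type := set_type [set J | biclosed J].

HB.instance Definition _ := SubChoice.on biclosed_set.

(* The order is induced from the one on [set Phip], which is inclusion. *)
HB.instance Definition _ := 
  [SubChoice_isSubPOrder of biclosed_set by <: with set_display].

End AffineVectorSpace.

Definition complete_lattice (d : Order.disp_t) (L : porderType d) : Prop :=
  forall X : set L, supremums X !=set0 /\ infimums X !=set0.

(* Main.v *)
Require Import Defs.
From HB Require Import structures.
From mathcomp Require Import all_boot all_order all_algebra.
From mathcomp Require Import boolp classical_sets reals.
From mathcomp Require Import freeg zify lra.

(* By complementation everything reduces to the join, that is, to showing that
   the closure of a coclosed set of roots is coclosed.  Write a set of roots as
   a relation U on the integers (i related to j when e_j - e_i is in the set)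
   and let i -> j mean that there is a U-path from i to j.  The closure of U
   consists of the pairs i, j, with i and j not congruent mod n, such that i
   reaches some j - s n and some j + t n, where s and t are nonnegative.  If U
   is coclosed and i reaches some integer congruent to k, then either i reaches
   the integer congruent to k in the interval (i, i + n), or the same holds with
   i and k exchanged.  Indeed, otherwise let S be the set of the integers
   congruent to i or k; coclosedness shows that every integer reached from i
   lies outside S and is reached from the last element of S before it.  The
   coclosedness of the closure follows by cutting paths. *)

Set Implicit Arguments.
Unset Strict Implicit.
Unset Printing Implicit Defensive.

Import Order.TTheory GRing.Theory Num.Theory.

Local Open Scope ring_scope.
Local Open Scope quotient_scope.
Local Open Scope classical_set_scope.

(** * Paths in shift-invariant relations on the integers *)

Section Residues.
Variable N : int.
Hypothesis N_gt0 : 0 < N.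

Local Notation res i := (i %% N)%Z.

Lemma res_shift i p : res (i + p * N) = res i.
Proof. by rewrite addrC modzMDl. Qed.

Lemma res_eqP i j : res i = res j -> exists p, j = i + p * N.
Proof.
move=> /esym/eqP; rewrite eqz_mod_dvd => /dvdzP[p e].
by exists p; rewrite -e addrC subrK.
Qed.

Lemma res_lt i j : res i = res j -> i < j -> i + N <= j.
Proof.
move=> /res_eqP[p ->]; rewrite ltrDl pmulr_lgt0 // => p_gt0.
by rewrite lerD2l; apply: ler_peMl; [exact: ltW|lia].
Qed.

Lemma res_nextP x k : exists y, [/\ res y = res k, x < y & y <= x + N].
Proof.
exists (x + 1 + res (k - (x + 1))).
have h0 := modz_ge0 (k - (x + 1)) (lt0r_neq0 N_gt0).
have h1 := ltz_pmod (k - (x + 1)) N_gt0.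
split; [|lia..].
by rewrite modzDmr; congr (res _); lia.
Qed.

End Residues.

Inductive reach (U : int -> int -> Prop) : int -> int -> Prop :=
| reach_edge i j of U i j : reach U i j
| reach_cons i j k of U i j & reach U j k : reach U i k.

Section Reach.
Variable N : int.
Hypothesis N_gt0 : 0 < N.
Local Notation res i := (i %% N)%Z.

(* Up to translation and exchange, the pairs of roots (a, b), (c, d) such that
   the root (i, k) lies in their cone.  The degenerate cases, in which (i, k) is
   one of the two roots, are included. *)
Inductive in_cone (i k : int) : int -> int -> int -> int -> Prop :=
| cone_chain j of res i <> res j & res j <> res k & i < j & j < k :
    in_cone i k i j j k
| cone_between k1 k2 of res k1 = res k & res k2 = res k & i < k1 & k1 <= k & k <= k2 :
    in_cone i k i k1 i k2
| cone_loop j i' of res j = res k & res i' = res i & i < j & j <= k & j < i' :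
    in_cone i k i j j i'.

Definition pair_closed (J : int -> int -> Prop) :=
  forall i k a b c d, res i <> res k -> i < k -> in_cone i k a b c d ->
    J a b -> J c d -> J i k.

Variable U : int -> int -> Prop.
Hypothesis U_lt : forall i j, U i j -> i < j.
Hypothesis U_res : forall i j, U i j -> res i <> res j.
Hypothesis U_shift : forall i j p, U i j -> U (i + p * N) (j + p * N).

Local Notation T := (reach U).

Lemma reach_trans i j k : T i j -> T j k -> T i k.
Proof.
elim=> [{}i {}j uij|{}i u {}j uiu _ IH /IH]; exact: reach_cons.
Qed.

Lemma reach_lt i j : T i j -> i < j.
Proof. by elim=> [? ? /U_lt//|? ? ? /U_lt h _ /(lt_trans h)]. Qed.

Lemma reach_shift i j p : T i j -> T (i + p * N) (j + p * N).
Proof.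
elim=> [? ? /(U_shift p) /reach_edge//|? ? ? /(U_shift p) h _]; exact: reach_cons.
Qed.

(** Follow the path until it visits [j] or an edge [U u v] jumps over [j]. The alternatives [u = i]
    and [v = k] make up for [reach] having no empty path. *)
Lemma reach_cross i j k : T i k -> i < j -> j < k ->
  (T i j /\ T j k) \/
  exists u v, [/\ u = i \/ T i u, U u v, v = k \/ T v k, u < j & j < v].
Proof.
move=> t; elim: t j => {i k} [i k uik|i x k uix txk IH] j ij jk.
  by right; exists i, k; split; auto.
have [jx|xj|->] := ltgtP j x; first by right; exists i, x; split; auto.
  case: (IH _ xj jk) => [[h1 h2]|[u [v [h1 h2 h3 h4 h5]]]].
    by left; split => //; apply: reach_cons uix h1.
  right; exists u, v; split=> //; right.
  by case: h1 => [->|h1]; [exact: reach_edge | exact: reach_cons h1].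
by left; split=> //; exact: reach_edge.
Qed.

(** * Reachability up to translation by the period *)

Definition accessible i k := exists p, T i (k + p * N).
Definition reach_below i k := exists2 s, 0 <= s & T i (k - s * N).
Definition reach_above i k := exists2 t, 0 <= t & T i (k + t * N).
(** A class other than that of [i] has exactly one element between [i] and [i + N], so this depends
    only on the residues of [i] and [k]. *)
Definition reach_short i k := exists k', [/\ res k' = res k, k' < i + N & T i k'].

Local Notation acc := accessible.
Local Notation lower := reach_below.
Local Notation upper := reach_above.
Local Notation short := reach_short.

Lemma res_accessible i k k' : res k' = res k -> T i k' -> acc i k.
Proof. by move/esym/res_eqP => [p ->] h; exists p. Qed.

Lemma accessible_trans i j k : acc i j -> acc j k -> acc i k.
Proof.
move=> [p h1] [q /(reach_shift p) h2]; exists (q + p).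
have -> : k + (q + p) * N = k + q * N + p * N by lia.
exact: reach_trans h2.
Qed.

Lemma reach_below_accessible i k : lower i k -> acc i k.
Proof. by move=> [s _ h]; exists (- s); rewrite mulNr. Qed.

Lemma reach_above_accessible i k : upper i k -> acc i k.
Proof. by move=> [s _ h]; exists s. Qed.

Lemma reach_short_accessible i k : short i k -> acc i k.
Proof. by move=> [k' [e _ h]]; apply: res_accessible h. Qed.

Lemma res_reach_below i k k' : res k' = res k -> k' <= k -> T i k' -> lower i k.
Proof.
move=> /res_eqP[p e] le h; exists p; first by rewrite -(pmulr_lge0 _ N_gt0); lia.
by have -> : k - p * N = k' by lia.
Qed.

Lemma res_reach_above i k k' : res k' = res k -> k <= k' -> T i k' -> upper i k.
Proof.
move=> /res_eqP[p e] le h; exists (- p); first by rewrite -(pmulr_lge0 _ N_gt0); lia.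
by have -> : k + - p * N = k' by lia.
Qed.

Lemma reach_below_shift i k p : lower i k -> lower (i + p * N) (k + p * N).
Proof.
move=> [s s0 /(reach_shift p) h]; exists s => //.
by have -> : k + p * N - s * N = k - s * N + p * N by lia.
Qed.

Lemma reach_above_shift i k p : upper i k -> upper (i + p * N) (k + p * N).
Proof.
move=> [s s0 /(reach_shift p) h]; exists s => //.
by have -> : k + p * N + s * N = k + s * N + p * N by lia.
Qed.

Lemma reach_short_below i k : short i k -> i < k -> lower i k.
Proof.
move=> [k' [e lt h]] ik; apply: res_reach_below (h) => //.
by have [//|/(res_lt N_gt0 (esym e))] := leP k' k; lia.
Qed.

(** Translates of a loop can be concatenated. A loop at either end of a path therefore pushes the
    end of the path above any bound, which turns [accessible] into [reach_above]. *)
Lemma loop_unbounded i (m : nat) : acc i i -> exists2 c, m%:Z <= c & T i (i + c * N).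
Proof.
move=> [p h]; have lt := reach_lt h; have p_gt0 : 0 < p by rewrite -(pmulr_lgt0 _ N_gt0); lia.
elim: m => [|m [c cm hc]]; first by exists p => //; lia.
exists (c + p); first by lia.
apply: reach_trans h _.
have -> : i + (c + p) * N = i + c * N + p * N by lia.
exact: reach_shift.
Qed.

Lemma loopl_reach_above i k : acc i i -> acc i k -> upper i k.
Proof.
move=> l [q h]; have [c qc hc] := loop_unbounded `|q| l.
exists (q + c); first by lia.
have -> : k + (q + c) * N = k + q * N + c * N by lia.
exact: reach_trans hc (reach_shift c h).
Qed.

Lemma loopr_reach_above i k : acc k k -> acc i k -> upper i k.
Proof.
move=> l [q h]; have [c qc hc] := loop_unbounded `|q| l.
exists (q + c); first by lia.
apply: reach_trans h _.
have -> : k + (q + c) * N = k + c * N + q * N by lia.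
exact: reach_shift.
Qed.

Hypothesis U_coclosed : forall i k a b c d, in_cone i k a b c d ->
  U i k -> U a b \/ U c d.

Let U_split i j k : i < j -> j < k -> res i <> res j -> res j <> res k ->
  U i k -> U i j \/ U j k.
Proof. by move=> ij jk eij ejk; apply/U_coclosed/cone_chain. Qed.

(** The classes of [i] and [k] span a subsystem of type affine $A_1$ with simple roots [(i, k')] and
    [(k', i + N)], where [k'] is the first element of the class of [k] after [i]. The root [(i, k)]
    lies in their cone. *)
Let U_rank2 i k : U i k ->
  exists k', [/\ res k' = res k, i < k', k' < i + N & U i k' \/ U k' (i + N)].
Proof.
move=> uik; have ik := U_lt uik.
have [k' [e ik' k'N]] := res_nextP N_gt0 i k.
have k'iN : k' < i + N.
  rewrite lt_neqAle k'N andbT; apply/eqP => e'.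
  by apply: (U_res uik); rewrite -e e' modzDr.
exists k'; split=> //; apply: U_coclosed uik; apply: cone_loop => //.
  by rewrite modzDr.
by have [//|/(res_lt N_gt0 (esym e))] := leP k' k; lia.
Qed.

(** * Two residue classes without short paths between them *)

Section Incomparable.
Variables a b : int.
Hypothesis ab : res a <> res b.

Let S x := res x = res a \/ res x = res b.
(* [p] and [r] range over the two residue classes, and a path between the
   classes that is shorter than [N] is excluded in both directions. *)
Hypothesis no_short : forall p r, S p -> S r -> r < p + N -> ~ T p r.

Let no_edge p r : S p -> S r -> ~ U p r.
Proof.
move=> Sp Sr /U_rank2[r' [e lt1 lt2]].
have Sr' : S r' by rewrite /S e.
have SpN : S (p + N) by rewrite /S modzDr.
by case=> /reach_edge; apply: no_short => //; lia.
Qed.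

Let otherP p : S p -> exists p', [/\ S p', res p' <> res p, p < p' & p' <= p + N].
Proof.
case=> e.
  have [q [e' h1 h2]] := res_nextP N_gt0 p b; exists q.
  by split; rewrite ?e' ?e; [right|congruence|..].
have [q [e' h1 h2]] := res_nextP N_gt0 p a; exists q.
by split; rewrite ?e' ?e; [left|congruence|..].
Qed.

Let edge_to_S x r q : ~ S x -> S r -> S q -> x < r -> r < q -> U x q -> U x r.
Proof.
move=> nSx Sr Sq xr rq uxq.
have nx y : S y -> res x <> res y by move=> Sy e; apply: nSx; rewrite /S e.
have [e|ne] := pselect (res r = res q); last first.
  by case: (U_split xr rq (nx _ Sr) ne uxq) => // /no_edge; case.
have [r2 [Sr2 ne rr2 r2N]] := otherP Sr.
have r2q : r2 < q.
  by have := res_lt N_gt0 e rq; have : r2 <> q by [move=> h; apply: ne; rewrite h e]; lia.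
have : U x r2.
  case: (@U_split x r2 q _ r2q (nx _ Sr2) _ uxq) => //; first by lia.
  - by rewrite -e.
  - by move/no_edge; case.
case/(U_split xr rr2 (nx _ Sr) (nesym ne)) => // /no_edge; by case.
Qed.

Let edge_from_S q r y : S q -> S r -> ~ S y -> q < r -> r < y -> U q y -> U r y.
Proof.
move=> Sq Sr nSy qr ry uqy.
have ny x : S x -> res x <> res y by move=> Sx e; apply: nSy; rewrite /S -e.
have [e|ne] := pselect (res q = res r); last first.
  by case: (U_split qr ry ne (ny _ Sr) uqy) => // /no_edge; case.
have [r2 [Sr2 ne qr2 r2N]] := otherP Sq.
have r2r : r2 < r.
  by have := res_lt N_gt0 e qr; have : r2 <> r by [move=> h; apply: ne; rewrite h e]; lia.
have : U r2 y.
  case: (@U_split q r2 y qr2 _ (nesym ne) (ny _ Sr2) uqy) => //; first by lia.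
  by move/no_edge; case.
case/(U_split r2r ry _ (ny _ Sr)) => //; first by rewrite -e.
by move/no_edge; case.
Qed.

Let predP x : exists p, [/\ S p, p < x & forall q, S q -> q < x -> q <= p].
Proof.
(* The window from [x - N] to [x - 1] contains one element of each class, namely the last one before
   [x]. *)
have [p [ep p1 p2]] := res_nextP N_gt0 (x - 1 - N) a.
have [q [eq q1 q2]] := res_nextP N_gt0 (x - 1 - N) b.
have B c d : res c = res d -> x - 1 - N < c -> d < x -> d <= c.
  by move=> e h1 h2; have [//|/(res_lt N_gt0 e)] := leP d c; lia.
exists (Num.max p q); split; first by rewrite /S; case: leP => _; auto.
  by lia.
move=> r [e|e] h; [have := B p r|have := B q r]; rewrite e ?ep ?eq => /(_ erefl); lia.
Qed.

Let succP x : exists p, [/\ S p, x < p & forall q, S q -> x < q -> p <= q].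
Proof.
have [p [ep p1 p2]] := res_nextP N_gt0 x a.
have [q [eq q1 q2]] := res_nextP N_gt0 x b.
have B c d : res d = res c -> c <= x + N -> x < d -> c <= d.
  by move=> e h1 h2; have [//|/(res_lt N_gt0 e)] := leP c d; lia.
exists (Num.min p q); split; first by rewrite /S; case: leP => _; auto.
  by lia.
move=> r [e|e] h; [have := B p r|have := B q r]; rewrite e ?ep ?eq => /(_ erefl); lia.
Qed.

(* [x] is reached from the last element of [S] before [x]. *)
Let D x := exists p, [/\ S p, p < x, T p x & forall q, S q -> q < x -> q <= p].

(** An edge into [S] could be shortened to end at the first element [r] of [S] after [x]. The
    elements [p] and [r] surround [x] and are consecutive in [S], hence less than [N] apart, so the
    path from [p] through [x] to [r] would be short. *)
Let D_no_S x q : ~ S x -> D x -> S q -> ~ U x q.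
Proof.
move=> nSx [p [Sp px tpx pmax]] Sq uxq; have xq := U_lt uxq.
have [r [Sr xr rmin]] := succP x.
have uxr : U x r.
  have [rq|qr|->//] := ltgtP r q; first exact: edge_to_S uxq.
  by have := rmin _ Sq xq; lia.
apply: (no_short Sp Sr _ (reach_trans tpx (reach_edge uxr))).
have [p' [Sp' ne pp' p'N]] := otherP Sp.
have p'x : x < p'.
  have : p' <> x by move=> e; apply: nSx; rewrite -e.
  by have [//|p'x|->//] := ltgtP x p'; have := pmax _ Sp' p'x; lia.
have := rmin _ Sp' p'x.
have : p' <> p + N by move=> e; apply: ne; rewrite e modzDr.
lia.
Qed.

(** Let [q] be the last element of [S] before [y]. If [q] lies after [x], cutting the edge at [q]
    leaves [U q y] by [D_no_S]; otherwise [q] is also the last element before [x], and its path to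
    [x] is extended by the edge. *)
Let D_edge x y : ~ S x -> D x -> U x y -> ~ S y /\ D y.
Proof.
move=> nSx Dx uxy; have xy := U_lt uxy.
have nSy : ~ S y by move=> Sy; apply: (D_no_S nSx Dx Sy).
split=> //; have [q [Sq qy qmax]] := predP y.
have [xq|qx|e] := ltgtP x q; last by rewrite e in nSx.
  exists q; split=> //; apply: reach_edge.
  have nx z : S z -> res x <> res z by move=> Sz e; apply: nSx; rewrite /S e.
  have ny z : S z -> res z <> res y by move=> Sz e; apply: nSy; rewrite /S -e.
  case: (U_split xq qy (nx _ Sq) (ny _ Sq) uxy) => //.
  by move/(D_no_S nSx Dx Sq).
case: Dx => p [Sp px tpx pmax].
have e : q = p by apply/eqP; rewrite eq_le pmax //= qmax //; lia.
exists q; split=> //; rewrite e; apply: reach_trans tpx (reach_edge uxy).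
Qed.

Let D_reach x y : T x y -> ~ S x -> D x -> ~ S y /\ D y.
Proof.
elim=> {x y} [x y u nS d|x u y uxu _ IH nS d]; first exact: D_edge u.
by have [] := D_edge nS d uxu.
Qed.

Let D_start x y : S x -> U x y -> ~ S y /\ D y.
Proof.
move=> Sx uxy; have xy := U_lt uxy.
have nSy : ~ S y by move=> Sy; apply: (no_edge Sx Sy).
split=> //; have [q [Sq qy qmax]] := predP y; exists q; split=> //.
apply: reach_edge; have := qmax _ Sx xy.
by rewrite le_eqVlt => /orP[/eqP <-//|xq]; apply: edge_from_S uxy.
Qed.

(** The first edge leaves [S] and establishes [D], and both properties then propagate along the
    path. *)
Lemma no_short_no_reach x y : S x -> S y -> ~ T x y.
Proof.
move=> Sx Sy t; case: t Sx Sy => {x y} [x y u Sx Sy|x u y uxu t Sx Sy].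
  by have [] := D_start Sx u.
have [nS d] := D_start Sx uxu.
by have [] := D_reach t nS d.
Qed.

End Incomparable.

Lemma accessible_short i k : res i <> res k -> acc i k -> short i k \/ short k i.
Proof.
move=> ne [p h]; apply: contrapT => /not_orP[n1 n2].
have H c d : ~ short c d -> forall x y, res x = res c -> res y = res d -> y < x + N -> ~ T x y.
  move=> ns x y /res_eqP[q eq] ey lt t; apply: ns; exists (y + q * N).
  by rewrite res_shift; split=> //; [lia|rewrite eq; exact: reach_shift].
apply: (@no_short_no_reach i k ne _ i (k + p * N)) h; rewrite ?res_shift; auto.
have ref c : forall x y, res x = res c -> res y = res c -> y < x + N -> ~ T x y.
  move=> x y ex ey lt /reach_lt /(res_lt N_gt0); rewrite ex ey => /(_ erefl); lia.
move=> x y [ex|ex] [ey|ey] lt; [exact: (ref i)|exact: (H i k)|exact: (H k i)|exact: (ref k)].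
Qed.

(** * Cutting paths at an intermediate integer *)

(** An edge that jumps over [j] can be cut at [j] by coclosedness unless one of its ends is
    congruent to [j]; the last two cases record such an end. *)
Lemma reach_split i j k : res i <> res j -> res j <> res k -> i < j -> j < k -> T i k ->
  [\/ T i j, T j k, (exists u, [/\ res u = res j, u < j, T i u & T u k]) |
    exists v, [/\ res v = res j, j < v, T i v & T v k]].
Proof.
move=> eij ejk ij jk /reach_cross /(_ ij jk) [[? _]|[u [v [iu uuv vk uj jv]]]].
  by constructor 1.
have [e|nuj] := pselect (res u = res j).
  constructor 3; exists u; case: iu => [eu|tiu]; first by rewrite -eu in eij.
  split=> //; case: vk => [<-|tvk]; [exact: reach_edge|exact: reach_cons tvk].
have [e|njv] := pselect (res v = res j).
  constructor 4; exists v; case: vk => [ev|tvk]; first by rewrite -ev e in ejk.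
  split=> //; case: iu => [<-|tiu]; [exact: reach_edge|exact: reach_trans tiu (reach_edge uuv)].
case: (U_split uj jv nuj (nesym njv) uuv) => [/reach_edge t|/reach_edge t].
  by constructor 1; case: iu => [<-//|tiu]; exact: reach_trans tiu t.
by constructor 2; case: vk => [<-//|tvk]; exact: reach_trans t tvk.
Qed.

Lemma reach_above_split i j k : res i <> res j -> res j <> res k -> i < j -> j < k ->
  upper i k -> upper i j \/ upper j k.
Proof.
move=> eij ejk ij jk [t t0 h].
have tN : 0 <= t * N by rewrite pmulr_lge0.
have jkt : j < k + t * N by lia.
case: (@reach_split i j (k + t * N)) => //; first by rewrite res_shift.
- by move=> h'; left; exists 0 => //; rewrite mul0r addr0.
- by move=> h'; right; exists t.
(* Translating the path that starts at [u] up to [j] only raises its endpoint. *)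
- move=> [u [/res_eqP[p e] uj _ /(reach_shift p) tuk]]; right; exists (t + p).
    by rewrite -(pmulr_lge0 _ N_gt0); lia.
  by rewrite mulrDl addrA e.
- by move=> [v [e jv tiv _]]; left; apply: res_reach_above tiv => //; exact: ltW.
Qed.

Lemma reach_below_split i j k : res i <> res j -> res j <> res k -> i < j -> j < k ->
  lower i k -> acc i j \/ acc j k -> lower i j \/ lower j k.
Proof.
move=> eij ejk ij jk [s s0 h] ij_jk.
have ek : res (k - s * N) = res k by rewrite -mulNr res_shift.
have [jk0|k0j|e] := ltgtP j (k - s * N); last by rewrite -{1}ek -e in ejk.
  case: (@reach_split i j (k - s * N)) => //; first by rewrite ek.
  - by move=> h'; left; apply: res_reach_below h'.
  - by move=> h'; right; exists s.
  - by move=> [u [e uj tiu _]]; left; apply: res_reach_below tiu => //; exact: ltW.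
  - move=> [v [/esym/res_eqP[p e] jv _ /(reach_shift (- p)) tvk]]; right; exists (s + p).
      by rewrite -(pmulr_lge0 _ N_gt0); lia.
    have -> : k - (s + p) * N = k - s * N + - p * N by lia.
    by have -> : j = v + - p * N by lia.
(* The path from [i] stops before [j], so there is nothing to cut. A short path from [k], translated
   to start at [k - s * N], ends at the first element of the class of [j] after it, hence not beyond
   [j]. *)
have kj_lower : short k j -> lower i j.
  move=> [j' [e lt t]]; have /res_eqP[p ep] := ek.
  have t' := reach_shift (- p) t.
  have e1 : k + - p * N = k - s * N by lia.
  apply: (@res_reach_below i j (j' + - p * N)); first by rewrite res_shift.
    have [//|/(@res_lt _ N_gt0)] := leP (j' + - p * N) j.
    by rewrite res_shift e => /(_ erefl); lia.
  by apply: reach_trans h _; rewrite -e1.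
have jk_case : acc j k -> lower i j \/ lower j k.
  by case/(accessible_short ejk) => [/reach_short_below /(_ jk)|/kj_lower]; auto.
case: ij_jk => // /(accessible_short eij).
case=> [/reach_short_below /(_ ij)|/reach_short_accessible ji]; auto.
by apply: jk_case; apply: accessible_trans ji _; apply: res_accessible ek h.
Qed.

(** The two previous lemmas may select different halves. In that case the missing lower bound rules
    out one alternative of [accessible_short], and the other one closes a loop at [j], which
    supplies the upper bound. *)
Lemma reach_both_split i j k : res i <> res j -> res j <> res k -> i < j -> j < k ->
  lower i k -> upper i k -> (lower i j /\ upper i j) \/ (lower j k /\ upper j k).
Proof.
move=> eij ejk ij jk lik uik.
have ujk := reach_above_split eij ejk ij jk uik.
have ac : acc i j \/ acc j k by case: ujk => /reach_above_accessible; auto.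
have ljk := reach_below_split eij ejk ij jk lik ac.
case: (pselect (lower i j)) ljk => [l1 _|nl [//|l2]].
  case: ujk => [|u2]; first by auto.
  have [l2|nl2] := pselect (lower j k); first by auto.
  left; split=> //; have ij' := reach_below_accessible l1.
  apply: loopr_reach_above => //.
  case: (accessible_short ejk (reach_above_accessible u2)) => [/reach_short_below/(_ jk)//|].
  move/reach_short_accessible; apply: accessible_trans; exact: reach_above_accessible.
case: ujk => [u1|]; last by auto.
right; split=> //; have jk' := reach_below_accessible l2.
apply: loopl_reach_above => //.
case: (accessible_short eij (reach_above_accessible u1)) => [/reach_short_below/(_ ij)//|].
move/reach_short_accessible/accessible_trans; apply; exact: reach_above_accessible.
Qed.

(** * The closure of a coclosed relation *)

(** The root of [(i, k)] lies on the segment between the roots of [(i, k - s * N)] and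
    [(i, k + t * N)], both of which are sums of roots along paths. *)
Definition hull i k := [/\ res i <> res k, lower i k & upper i k].

Lemma reach_hull i k : res i <> res k -> T i k -> hull i k.
Proof. by move=> e h; split=> //; exists 0; rewrite // mul0r ?subr0 ?addr0. Qed.

Lemma hull_lt i k : hull i k -> i < k.
Proof.
move=> [_ [s s0 /reach_lt h] _]; have : 0 <= s * N by rewrite pmulr_lge0.
by lia.
Qed.

Lemma hull_shift i k p : hull i k -> hull (i + p * N) (k + p * N).
Proof.
move=> [e l u]; split; first by rewrite !res_shift.
  exact: reach_below_shift.
exact: reach_above_shift.
Qed.

Lemma reach_below_mono i k k' : res k' = res k -> k <= k' -> lower i k -> lower i k'.
Proof.
move=> e le [s s0 h]; have sN : 0 <= s * N by rewrite pmulr_lge0.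
apply: res_reach_below h; first by rewrite -mulNr res_shift.
by lia.
Qed.

Lemma reach_above_mono i k k' : res k' = res k -> k' <= k -> upper i k -> upper i k'.
Proof.
move=> e le [s s0 h]; have sN : 0 <= s * N by rewrite pmulr_lge0.
apply: res_reach_above h; first by rewrite res_shift.
by lia.
Qed.

Lemma reach_below_trans i j k : lower i j -> lower j k -> lower i k.
Proof.
move=> [s s0 h] [s' s'0 /(reach_shift (- s)) h']; exists (s + s'); first by lia.
apply: reach_trans (h) _.
have -> : k - (s + s') * N = k - s' * N + - s * N by lia.
by have -> : j - s * N = j + - s * N by lia.
Qed.

Lemma reach_above_trans i j k : upper i j -> upper j k -> upper i k.
Proof.
move=> [s s0 h] [s' s'0 /(reach_shift s) h']; exists (s + s'); first by lia.
apply: reach_trans (h) _.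
by have -> : k + (s + s') * N = k + s' * N + s * N by lia.
Qed.

Lemma accessible_res i i' k k' : res i = res i' -> res k = res k' -> acc i k -> acc i' k'.
Proof.
move=> /res_eqP[p ->] /res_eqP[q ->] [r /(reach_shift p) h]; exists (r + p - q).
by have -> : k + q * N + (r + p - q) * N = k + r * N + p * N by lia.
Qed.

Lemma reach_short_res i i' k k' : res i = res i' -> res k = res k' -> short i k -> short i' k'.
Proof.
move=> /res_eqP[p ->] e [y [ey lt /(reach_shift p) h]]; exists (y + p * N).
by split=> //; [rewrite res_shift ey | lia].
Qed.

Lemma hull_closed : pair_closed hull.
Proof.
move=> i k a b c d eik ik.
case=> [j _ _ _ _|k1 k2 e1 e2 _ l1 l2|j i' ej ei' _ jk _] [h1 l u] [h2 l' u'].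
- split=> //; [exact: reach_below_trans l l'|exact: reach_above_trans u u'].
- split=> //; [exact: reach_below_mono l|exact: reach_above_mono u'].
- split=> //; first exact: reach_below_mono l.
  apply: loopl_reach_above.
    apply: accessible_trans (reach_below_accessible l) _.
    by apply: accessible_res (reach_below_accessible l').
  by apply: accessible_res (reach_below_accessible l).
Qed.

(** In the last two cases, [accessible_short] either gives a short path, hence the lower bound for
    the first pair, or a path back to the class of [i], hence a loop and the upper bound for the
    second pair. *)
Lemma hull_coclosed i k a b c d : in_cone i k a b c d -> hull i k -> hull a b \/ hull c d.
Proof.
move=> C [eik lik uik].
have ac := reach_below_accessible lik.
have loop : short k i -> acc i i by move/reach_short_accessible; apply: accessible_trans.
case: C => [j eij ejk ij jk|k1 k2 e1 e2 ik1 k1k kk2|j i' ej ei' ij jk ji'].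
- by case: (reach_both_split eij ejk ij jk lik uik) => -[]; [left|right].
- case: (accessible_short eik ac) => [/(reach_short_res erefl (esym e1)) s|/loop l].
    left; split; [by rewrite e1|exact: reach_short_below|exact: reach_above_mono uik].
  right; split; [by rewrite e2|exact: reach_below_mono lik|].
  by apply: loopl_reach_above => //; apply: accessible_res ac.
- case: (accessible_short eik ac) => [/(reach_short_res erefl (esym ej)) s|s].
    left; split; [by rewrite ej|exact: reach_short_below|exact: reach_above_mono uik].
  have s' := reach_short_res (esym ej) (esym ei') s.
  right; split; [by rewrite ej ei'; exact: nesym|exact: reach_short_below|].
  apply: loopl_reach_above; last exact: reach_short_accessible.
  apply: accessible_trans (reach_short_accessible s') _.
  by apply: accessible_res ac.
Qed.

Lemma reach_sub_closed J i k : pair_closed J -> (forall x y, U x y -> J x y) ->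
  res i <> res k -> T i k -> J i k.
Proof.
move=> Jcl UJ eik t.
(* The tail of a path may join congruent integers, which form no root. The induction then provides a
   point [y] that cuts the tail into two members of [J]. *)
suff H : (res i <> res k -> J i k) /\
    (res i = res k -> exists y, [/\ i < y, y < k, res y <> res k, J i y & J y k]).
  exact: H.1.
elim: t => {i k eik} [i k uik|i j k uij tjk [IH1 IH2]].
  by split=> [_|e]; [exact: UJ|case: (U_res uik)].
have eij := U_res uij; have ij := U_lt uij; have jk := reach_lt tjk.
split=> e; last first.
  have ejk : res j <> res k by move=> e'; apply: eij; rewrite e -e'.
  by exists j; split=> //; [exact: UJ|exact: IH1].
have [ejk|ejk] := pselect (res j = res k); last first.
  apply: (Jcl i k i j j k) => //; [lia|exact: cone_chain|exact: UJ|exact: IH1].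
have [y [jy yk eyk Jjy Jyk]] := IH2 ejk.
have [eyi|eyi] := pselect (res y = res i).
  by apply: (Jcl i k i j j y) => //; [lia|apply: cone_loop => //; lia|exact: UJ].
have Jiy : J i y.
  apply: (Jcl i y i j j y) => //; [exact: nesym|lia| |exact: UJ].
  by apply: cone_chain => //; rewrite ejk; exact: nesym.
apply: (Jcl i k i y y k) => //; first by lia.
by apply: cone_chain => //; [exact: nesym|lia].
Qed.

Lemma hull_sub_closed J i k : pair_closed J -> (forall x y, U x y -> J x y) ->
  hull i k -> J i k.
Proof.
move=> Jcl UJ [eik [s s0 h] [t t0 h']].
have sN : 0 <= s * N by rewrite pmulr_lge0.
have tN : 0 <= t * N by rewrite pmulr_lge0.
have r1 : res (k - s * N) = res k by rewrite -mulNr res_shift.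
have r2 : res (k + t * N) = res k by rewrite res_shift.
have lt := reach_lt h.
apply: (Jcl i k i (k - s * N) i (k + t * N)) => //; first by lia.
- by apply: cone_between => //; lia.
- by apply: reach_sub_closed h; rewrite ?r1.
- by apply: reach_sub_closed h'; rewrite ?r2.
Qed.

End Reach.

(** * Roots in the cone of two roots *)

Section SimpleCone.
Variables (R : realFieldType) (T : eqType).
Implicit Types (i k a b c d : T) (x y : R).

(** This compares coordinates in $e_k - e_i = x(e_b - e_a) + y(e_d - e_c)$. It is used with residues
    as indices, that is, modulo the null root. *)
Let unit_coord x y i k a b c d := forall r, (k == r)%:R - (i == r)%:R =
    x * ((b == r)%:R - (a == r)%:R) + y * ((d == r)%:R - (c == r)%:R) :> R.

Lemma chain_unit_coord x y i k a b d :
  0 < x -> 0 < y -> i != k -> a != b -> b != d -> unit_coord x y i k a b b d ->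
  [\/ [/\ i = a, k = d, x = 1 & y = 1],
      [/\ i = a, k = b, d = a & x = 1 + y] |
      [/\ i = b, k = d, d = a & y = 1 + x]].
Proof.
move=> x0 y0 ik ab bd e; have [ead|ad] := eqVneq a d.
  subst d; have := e k; have := e i; rewrite !eqxx (negPf ik) eq_sym (negPf ik).
  have [bi|bi] := eqVneq b i; have [ai|ai] := eqVneq a i;
  have [bk|bk] := eqVneq b k; have [ak|ak] := eqVneq a k => /= e1 e2;
  try (exfalso; lra); subst; rewrite ?eqxx // in ik ab *.
    by constructor 3; split=> //; lra.
  by constructor 2; split=> //; lra.
have := e a; have := e d; rewrite !eqxx (eq_sym b a) (negPf ab) (negPf ad) (negPf bd).
rewrite (eq_sym d) (negPf ad).
have [ia|ia] := eqVneq i a; have [ka|ka] := eqVneq k a;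
have [id|id] := eqVneq i d; have [kd|kd] := eqVneq k d => /= e1 e2; try (exfalso; lra).
by constructor 1; split=> //; lra.
Qed.

(** If [b] differs from [c] and [a] from [d], nothing cancels on the right: the coordinates at [a]
    and [c] are negative and those at [b] and [d] positive. The left side has one of each sign, so
    the three roots coincide. *)
Lemma cone_unit_coord x y i k a b c d :
  0 < x -> 0 < y -> i != k -> a != b -> c != d -> unit_coord x y i k a b c d ->
  [\/ b = c /\ [\/ [/\ i = a, k = d, x = 1 & y = 1],
                   [/\ i = a, k = b, d = a & x = 1 + y] |
                   [/\ i = b, k = d, d = a & y = 1 + x]],
      d = a /\ [/\ i = c, k = b, x = 1 & y = 1] |
      [/\ i = a, i = c, b = k, d = k & x + y = 1]].
Proof.
move=> x0 y0 ik ab cd e; have [ebc|bc] := eqVneq b c.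
  by subst c; constructor 1; split=> //; apply: chain_unit_coord e.
have [ead|ad] := eqVneq a d.
  subst d; have e' : unit_coord y x i k c a a b by move=> r; rewrite e addrC.
  constructor 2; split=> //.
  case: (chain_unit_coord y0 x0 ik cd ab e') => -[h1 h2 h3 h4].
  - by split.
  - by rewrite h3 eqxx in bc.
  - by rewrite h3 eqxx in bc.
have := e a; have := e b; have := e c; have := e d.
rewrite !eqxx (eq_sym b a) (negPf ab) (eq_sym d a) (negPf ad) (negPf bc).
rewrite (eq_sym c b) (negPf bc).
rewrite (eq_sym d c) (negPf cd).
have [ia|ia] := eqVneq i a; last by case: (c == a) (k == a) => -[] /= *; exfalso; lra.
have [ic|ic] := eqVneq i c; last by case: (a == c) (k == c) => -[] /= *; exfalso; lra.
subst a c; rewrite eqxx (negPf ab) (negPf cd) /=.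
have [kb|kb] := eqVneq k b; last by case: (d == b) => /= *; exfalso; lra.
have [kd|kd] := eqVneq k d; last by case: (b == d) => /= *; exfalso; lra.
subst b; rewrite -kd eqxx eq_sym (negPf ik) /= => *.
by constructor 3; split=> //; lra.
Qed.

End SimpleCone.

(** * Linear forms on the quotient space *)

Section Functionals.
Variables (R : realType) (n : nat).
Local Notation V := (Vhat R n).
Local Notation etilde := (@etilde R n).

Lemma pi_comb x y (u v : {freeg int / R}) :
  x *: \pi_V u + y *: \pi_V v = \pi_V (x *: u + y *: v).
Proof. by rewrite pi_VhatD !pi_Vscale. Qed.

Lemma etildeB i j : etilde j - etilde i = \pi_V (fgen R j - fgen R i).
Proof. by rewrite -[etilde j]scale1r -scaleN1r pi_comb scale1r scaleN1r. Qed.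

HB.instance Definition _ (f : int -> R^o) :=
  GRing.isZmodMorphism.Build {freeg int / R} R^o (fglift f) (lift_is_additive f).

Lemma fgliftZ (f : int -> R^o) c (u : {freeg int / R}) :
  fglift f (c *: u) = c *: fglift f u.
Proof.
have -> : fglift f u = \sum_(z <- dom u) coeff z u *: f z.
  by rewrite -[in LHS](freeg_sumE u) raddf_sum; apply: eq_bigr => z _; exact: liftU.
rewrite [c *: u]/(fgscale c u) raddf_sum scaler_sumr.
by apply: eq_bigr => z _; rewrite scalerA; exact: liftU.
Qed.

Variable f : int -> R^o.
Hypothesis f_shift : forall i j, f (i + n%:Z) - f i = f (j + n%:Z) - f j.

Definition functional (v : V) : R := fglift f (repr v).

(** Two representatives differ by a combination of relators, on which the lift of [f] vanishes by
    [f_shift]. *)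
Lemma functional_pi u : functional (\pi u) = fglift f u.
Proof.
have : \pi_V (repr (\pi_V u)) = \pi_V u by rewrite reprK.
move/eqP; rewrite piE Quotient.equivE => /asboolP[s e].
apply/eqP; rewrite -subr_eq0 /functional -raddfB /= e raddf_sum /= big1 // => c _.
rewrite fgliftZ; suff -> : fglift f (relator R n c.2) = 0 by rewrite scaler0.
rewrite !raddfB /= !liftU !scale1r (f_shift c.2.1 c.2.2) -opprD; exact: subrr.
Qed.

Lemma functional_comb x y u v : functional (x *: u + y *: v) = x * functional u + y * functional v.
Proof.
rewrite -[u]reprK -[v]reprK pi_comb !functional_pi.
by rewrite raddfD /= !fgliftZ.
Qed.

Lemma functional_root i j : functional (etilde j - etilde i) = f j - f i.
Proof. by rewrite etildeB functional_pi raddfB /= !liftU !scale1r. Qed.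

End Functionals.

(** * Roots as pairs of integers up to translation *)

Section Roots.
Variables (R : realType) (n : nat).
Hypothesis n_gt0 : (0 < n)%N.
Local Notation N := (n%:Z).
Local Notation V := (Vhat R n).
Local Notation etilde := (@etilde R n).
Local Notation res i := (i %% N)%Z.

Let N_gt0 : 0 < N. Proof. by rewrite ltz_nat. Qed.

(** The imaginary root, which is the common value of all [etilde (i + N) - etilde i]. *)
Definition null_root : V := etilde N - etilde 0.

Lemma etildeD_period i : etilde (i + N) = etilde i + null_root.
Proof.
rewrite /null_root.
suff : etilde (i + N) - etilde i = etilde N - etilde 0 by move=> <-; rewrite [RHS]addrC subrK.
apply/eqP; rewrite !etildeB piE Quotient.equivE.
apply/asboolP; exists [:: (1, (i, 0))].
by rewrite big_seq1 scale1r /relator /= add0r.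
Qed.

Lemma etilde_shift i p : etilde (i + p * N) = etilde i + p%:~R *: null_root.
Proof.
elim/int_ind: p => [|p IH|p IH].
- by rewrite mul0r scale0r !addr0.
- have -> : i + p.+1%:Z * N = i + p%:Z * N + N by lia.
  rewrite etildeD_period IH -addrA -[X in _ + (_ + X)]scale1r -scalerDl.
  by congr (_ + _ *: _); rewrite -[1 in LHS]/(1%:~R) -intrD; congr (_%:~R); lia.
- have e : i + - p%:Z * N = i + - p.+1%:Z * N + N by lia.
  apply: (addIr null_root).
  rewrite -etildeD_period -e IH -addrA -[X in _ + (_ + X)]scale1r -scalerDl.
  by congr (_ + _ *: _); rewrite -[1 in RHS]/(1%:~R) -intrD; congr (_%:~R); lia.
Qed.

Definition root_pair (g : @Phip R n) i j :=
  [/\ res i <> res j, i < j & val g = etilde j - etilde i].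

Lemma root_pairP g : exists i j, root_pair g i j.
Proof.
by case: (set_mem (valP g)) => i [j [ij /eqP e v]]; exists i, j.
Qed.

Lemma root_pair_exists i j : res i <> res j -> i < j -> exists g, root_pair g i j.
Proof.
move=> e ij.
have h : Phip (etilde j - etilde i) by exists i, j; split=> //; apply/eqP.
by exists (SigSub (mem_set h)).
Qed.

Lemma root_pair_inj g g' i j : root_pair g i j -> root_pair g' i j -> g = g'.
Proof. by move=> [_ _ e] [_ _ e']; apply: val_inj; rewrite e e'. Qed.

Lemma root_pair_shift g i j p : root_pair g i j -> root_pair g (i + p * N) (j + p * N).
Proof.
move=> [e ij v]; split; rewrite ?res_shift ?ltrD2r //.
by rewrite !etilde_shift v opprD addrACA subrr addr0.
Qed.

Lemma comb_functional (f : int -> R^o) x y g a b i k a1 a2 b1 b2 :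
  (forall i j, f (i + N) - f i = f (j + N) - f j) ->
  root_pair g i k -> root_pair a a1 a2 -> root_pair b b1 b2 ->
  val g = x *: val a + y *: val b ->
  f k - f i = x * (f a2 - f a1) + y * (f b2 - f b1).
Proof.
move=> fs [_ _ ->] [_ _ ->] [_ _ ->] /(congr1 (functional f)).
by rewrite functional_comb // !functional_root.
Qed.

Lemma comb_length x y g a b i k a1 a2 b1 b2 :
  root_pair g i k -> root_pair a a1 a2 -> root_pair b b1 b2 ->
  val g = x *: val a + y *: val b ->
  (k - i)%:~R = x * (a2 - a1)%:~R + y * (b2 - b1)%:~R :> R.
Proof.
move=> gi ai bi e; rewrite !intrB.
apply: (@comb_functional (fun i : int => i%:~R : R^o)) gi ai bi e => c d.
by rewrite -!intrB; congr (_%:~R); lia.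
Qed.

Lemma comb_unit_coord x y g a b i k a1 a2 b1 b2 :
  root_pair g i k -> root_pair a a1 a2 -> root_pair b b1 b2 ->
  val g = x *: val a + y *: val b -> forall r,
  (res k == r)%:R - (res i == r)%:R =
    x * ((res a2 == r)%:R - (res a1 == r)%:R) +
    y * ((res b2 == r)%:R - (res b1 == r)%:R) :> R.
Proof.
move=> gi ai bi e r.
apply: (@comb_functional (fun i : int => (res i == r)%:R : R^o)) gi ai bi e => c d.
by rewrite !modzDr !subrr.
Qed.

(** The indicator of the class of [j] shows that [j'] is congruent to [j], and the length form shows
    that both pairs have the same difference. *)
Lemma root_pair_uniq g i j i' j' : root_pair g i j -> root_pair g i' j' ->
  exists p, i' = i + p * N /\ j' = j + p * N.
Proof.
move=> gi gi'; have e : val g = 1 *: val g + 0 *: val g by rewrite scale1r scale0r addr0.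
have l := comb_length gi gi' gi' e; have u := comb_unit_coord gi gi' gi' e.
clear e; case: (gi) (gi') => [eij _ _] [eij' _ _].
move: l; rewrite mul1r mul0r addr0 => /eqP; rewrite eqr_int => /eqP l.
have ej : res j = res j'.
  have := u (res j); rewrite eqxx (introF eqP eij) mul1r mul0r addr0.
  case: eqP => // _ /esym h; suff: (1 : R) <= 0 by rewrite ler10.
  by rewrite -[1]subr0 -h sub0r oppr_le0 ler0n.
have [p ep] := res_eqP ej; exists p; split=> //; lia.
Qed.

Definition in_open_cone (g a b : @Phip R n) :=
  exists x y : R, [/\ 0 < x, 0 < y & val g = x *: val a + y *: val b].

Lemma in_open_coneC g a b : in_open_cone g a b -> in_open_cone g b a.
Proof. by move=> [x [y [x0 y0 e]]]; exists y, x; rewrite addrC. Qed.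

Lemma in_cone_root i k a1 a2 b1 b2 g a b : in_cone N i k a1 a2 b1 b2 ->
  root_pair g i k -> root_pair a a1 a2 -> root_pair b b1 b2 ->
  [\/ g = a, g = b | in_open_cone g a b].
Proof.
case=> [j _ _ _ _|k1 k2 e1 e2 _ l1 l2|j i' ej ei' _ jk ji'] gi ai bi.
- constructor 3; exists 1, 1; split=> //.
  case: gi ai bi => [_ _ ->] [_ _ ->] [_ _ ->].
  by rewrite !scale1r [RHS]addrC addrA subrK.
- move: l1; rewrite le_eqVlt => /orP[/eqP ek|l1].
    by constructor 1; rewrite ek in ai; apply: root_pair_inj gi ai.
  move: l2; rewrite le_eqVlt => /orP[/eqP ek|l2].
    by constructor 2; rewrite -ek in bi; apply: root_pair_inj gi bi.
  constructor 3; have [p ep] := res_eqP e1; have [q eq] := res_eqP (etrans e1 (esym e2)).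
  have p0 : 0 < p by rewrite -(pmulr_lgt0 _ N_gt0); lia.
  have pq : 0 < q - p by rewrite -(pmulr_lgt0 _ N_gt0); lia.
  have p0R : 0 < p%:~R :> R by rewrite ltr0z.
  have pqR : 0 < (q - p)%:~R :> R by rewrite ltr0z.
  have qR : 0 < q%:~R :> R by rewrite ltr0z; lia.
  (* With [k = k1 + p * N] and [k2 = k1 + q * N], these are the weights of [k] as a convex
     combination of [k1] and [k2]. *)
  exists ((q - p)%:~R / q%:~R), (p%:~R / q%:~R); split; [exact: divr_gt0..|].
  case: gi ai bi => [_ _ ->] [_ _ ->] [_ _ ->]; rewrite ep eq !etilde_shift.
  rewrite ![etilde k1 + _ - _]addrAC [_ *: (_ + _ *: null_root)]scalerDr.
  rewrite [RHS]addrA -scalerDl scalerA.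
  by rewrite -mulrDl -intrD subrK divff ?gt_eqF // scale1r divfK ?gt_eqF.
- have [p ep] := res_eqP ej; have [q eq] := res_eqP (esym ei').
  case: (gi) => _ ik _; case: (ai) => _ ij _.
  move: jk; rewrite le_eqVlt => /orP[/eqP ek|jk].
    by constructor 1; rewrite ek in ai; apply: root_pair_inj gi ai.
  constructor 3.
  have p0 : 0 < p by rewrite -(pmulr_lgt0 _ N_gt0); lia.
  have q0 : 0 < q by rewrite -(pmulr_lgt0 _ N_gt0); lia.
  have p0R : 0 < p%:~R :> R by rewrite ltr0z.
  have qR : 0 < q%:~R :> R by rewrite ltr0z.
  (* The two roots add up to [q] null roots, and [k = j + p * N] requires [p] null roots on top of
     the first root. *)
  exists (1 + p%:~R / q%:~R), (p%:~R / q%:~R).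
  split; [by rewrite addr_gt0 ?divr_gt0|exact: divr_gt0|].
  case: gi ai bi => [_ _ ->] [_ _ ->] [_ _ ->]; rewrite ep eq !etilde_shift.
  rewrite scalerDl scale1r -[RHS]addrA -scalerDr.
  have -> : etilde j - etilde i + (etilde i + q%:~R *: null_root - etilde j) =
    q%:~R *: null_root.
    by rewrite -[_ + _ - etilde j]addrA [LHS]addrA subrK addrC subrK.
  by rewrite scalerA divfK ?gt_eqF // addrAC.
Qed.

Lemma chain_in_cone i k a b c d : res a <> res b -> res c <> res d -> a < b -> c < d ->
  res i = res a -> res b = res c -> res k = res d -> k - i = (b - a) + (d - c) ->
  exists p q, in_cone N i k (a + p * N) (b + p * N) (c + q * N) (d + q * N).
Proof.
move=> eab ecd ab cd ia bc kd l.
have [p ep] := res_eqP (esym ia).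
have [q eq] := res_eqP (etrans (esym bc) (esym (res_shift N b p))).
exists p, q; rewrite -ep -eq; have -> : d + q * N = k by lia.
by apply: cone_chain; rewrite ?res_shift ?ia ?kd ?bc //; [congruence|lia|lia].
Qed.

Lemma between_in_cone i k a b c d : a < b -> res i = res a -> res i = res c ->
  res b = res k -> res d = res k -> b - a <= k - i -> k - i <= d - c ->
  exists p q, in_cone N i k (a + p * N) (b + p * N) (c + q * N) (d + q * N).
Proof.
move=> ab ia ic bk dk l1 l2.
have [p ep] := res_eqP (esym ia); have [q eq] := res_eqP (esym ic).
exists p, q; rewrite -ep -eq.
by apply: cone_between; rewrite ?res_shift //; lia.
Qed.

Lemma loop_in_cone i k a b c d : a < b -> c < d -> res i = res a -> res k = res b ->
  res c = res b -> res d = res a -> b - a <= k - i ->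
  exists p q, in_cone N i k (a + p * N) (b + p * N) (c + q * N) (d + q * N).
Proof.
move=> ab cd ia kb cb da l.
have [p ep] := res_eqP (esym ia).
have [q eq] := res_eqP (etrans cb (esym (res_shift N b p))).
exists p, q; rewrite -ep -eq.
by apply: cone_loop; rewrite ?res_shift ?da //; lia.
Qed.

(** The classification modulo the null root fixes the residues, and the length form then gives the
    inequalities that select the case of [in_cone]. Both orders occur because [in_cone] is not
    symmetric in the two pairs. *)
Lemma open_cone_in_cone i k a1 a2 b1 b2 g a b : in_open_cone g a b ->
  root_pair g i k -> root_pair a a1 a2 -> root_pair b b1 b2 ->
  (exists p q, in_cone N i k (a1 + p * N) (a2 + p * N) (b1 + q * N) (b2 + q * N)) \/
  (exists p q, in_cone N i k (b1 + p * N) (b2 + p * N) (a1 + q * N) (a2 + q * N)).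
Proof.
move=> [x [y [x0 y0 e]]] gi ai bi.
have l := comb_length gi ai bi e.
have u := comb_unit_coord gi ai bi e.
case: (gi) (ai) (bi) => [eik ik _] [ea a12 _] [eb b12 _].
have la : 0 < (a2 - a1)%:~R :> R by rewrite ltr0z subr_gt0.
have lb : 0 < (b2 - b1)%:~R :> R by rewrite ltr0z subr_gt0.
case: (cone_unit_coord x0 y0 (introN eqP eik) (introN eqP ea) (introN eqP eb) u).
- case=> bc [[ia kd ex ey]|[ia kb da ex]|[ib kd da ey]].
  + left; apply: chain_in_cone => //; apply/eqP; rewrite -(eqr_int R) l ex ey.
    by rewrite !mul1r -intrD.
  + left; apply: loop_in_cone => //; rewrite -(ler_int R) l; nra.
  + right; apply: loop_in_cone => //; [congruence|]; rewrite -(ler_int R) l; nra.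
- case=> da [ic kb ex ey]; right; apply: chain_in_cone => //; apply/eqP.
  by rewrite -(eqr_int R) l ex ey !mul1r -intrD addrC.
case=> ia ic bk dk xy.
have [le|lt] := leP (a2 - a1) (b2 - b1).
  have leR : (a2 - a1)%:~R <= (b2 - b1)%:~R :> R by rewrite ler_int.
  left; apply: between_in_cone => //; rewrite -(ler_int R) l; nra.
have leR : (b2 - b1)%:~R <= (a2 - a1)%:~R :> R by rewrite ler_int ltW.
right; apply: between_in_cone => //; rewrite -(ler_int R) l; nra.
Qed.

(** * Sets of roots as relations on the integers *)

Implicit Types J K : set (@Phip R n).

Definition pairs_of J i j := exists2 g, root_pair g i j & J g.

Lemma pairs_ofE J g i j : root_pair g i j -> pairs_of J i j <-> J g.
Proof.
move=> gi; split=> [[g' gi' Jg']|Jg]; last by exists g.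
by rewrite (root_pair_inj gi gi').
Qed.

Lemma pairs_of_shift J i j p : pairs_of J i j -> pairs_of J (i + p * N) (j + p * N).
Proof. by case=> g gi Jg; exists g => //; apply: root_pair_shift. Qed.

Lemma root_closedP J : root_closed J <-> pair_closed N (pairs_of J).
Proof.
split=> Jcl.
  move=> i k a b c d eik ik C [x xa Jx] [y yc Jy].
  have [g gi] := root_pair_exists eik ik; exists g => //.
  by case: (in_cone_root C gi xa yc) => [->//|->//|]; apply: Jcl.
move=> x y g Jx Jy /[dup] xyg /(in_open_coneC) yxg.
have [i [k gi]] := root_pairP g.
have [a1 [a2 xi]] := root_pairP x; have [b1 [b2 yi]] := root_pairP y.
apply/(pairs_ofE _ gi); case: (gi) => eik ik _.
by case: (open_cone_in_cone xyg gi xi yi) => -[p [q C]];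
   apply: Jcl C _ _ => //; apply: pairs_of_shift; [exists x|exists y|exists y|exists x].
Qed.

Lemma in_cone_lt i k a b c d : res i <> res k -> i < k -> in_cone N i k a b c d ->
  [/\ res a <> res b, a < b, res c <> res d & c < d].
Proof.
move=> eik ik.
case=> [j eij ejk ij jk|k1 k2 e1 e2 ik1 k1k kk2|j i' ej ei' ij jk ji']; split=> //;
  try congruence; lia.
Qed.

Lemma root_coclosedP J : root_coclosed J <->
  forall i k a b c d, in_cone N i k a b c d ->
    pairs_of J i k -> pairs_of J a b \/ pairs_of J c d.
Proof.
split=> Jco.
  move=> i k a b c d C [g gi Jg]; case: (gi) => eik ik _.
  have [eab ab ecd cd] := in_cone_lt eik ik C.
  have [x xa] := root_pair_exists eab ab; have [y yc] := root_pair_exists ecd cd.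
  rewrite (pairs_ofE J xa) (pairs_ofE J yc); apply: contrapT => /not_orP[nx ny].
  case: (in_cone_root C gi xa yc) => [e|e|gxy].
  - by apply: nx; rewrite -e.
  - by apply: ny; rewrite -e.
  - exact: (Jco x y g nx ny gxy).
move=> x y g nx ny gxy Jg.
have [i [k gi]] := root_pairP g.
have [a1 [a2 xi]] := root_pairP x; have [b1 [b2 yi]] := root_pairP y.
have Ji : pairs_of J i k by exists g.
have nxp p : ~ pairs_of J (a1 + p * N) (a2 + p * N).
  by rewrite (pairs_ofE J (root_pair_shift p xi)).
have nyp p : ~ pairs_of J (b1 + p * N) (b2 + p * N).
  by rewrite (pairs_ofE J (root_pair_shift p yi)).
case: (open_cone_in_cone gxy gi xi yi) => -[p [q C]].
  by case: (Jco _ _ _ _ _ _ C Ji) => [/nxp|/nyp].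
by case: (Jco _ _ _ _ _ _ C Ji) => [/nyp|/nxp].
Qed.

Lemma root_closure_closed K : root_closed (root_closure K).
Proof.
move=> a b g Ka Kb gab J [Jcl KJ].
by apply: (Jcl a b); [exact: Ka|exact: Kb|].
Qed.

(** The set [H] of roots given by [hull] is closed and contains [K], while [hull_sub_closed] places
    it in every closed set containing [K]. So it is the closure, and [hull_coclosed] applies. *)
Lemma root_closure_coclosed K : root_coclosed K -> root_coclosed (root_closure K).
Proof.
move=> /root_coclosedP Kco.
set U := pairs_of K.
have U_lt i j : U i j -> i < j by case=> g [].
have U_res i j : U i j -> res i <> res j by case=> g [].
have U_shift i j p : U i j -> U (i + p * N) (j + p * N) by exact: pairs_of_shift.
pose H : set (@Phip R n) := [set g | exists2 ij, root_pair g ij.1 ij.2 & hull N U ij.1 ij.2].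
have HE i j : pairs_of H i j <-> hull N U i j.
  split=> [[g gi [[i' j'] /= gi' h]]|h].
    by have [p [-> ->]] := root_pair_uniq gi' gi; apply: hull_shift.
  have [g gi] := root_pair_exists (let: And3 e _ _ := h in e) (hull_lt N_gt0 U_lt h).
  by exists g => //; exists (i, j).
have Hcl : root_closed H.
  apply/root_closedP => i k a b c d eik ik C /HE hab /HE hcd; apply/HE.
  exact: (hull_closed N_gt0 U_lt U_shift eik ik C hab hcd).
have KH : K `<=` H.
  move=> g Kg; have [i [j gi]] := root_pairP g; exists (i, j) => //=.
  by apply: reach_hull; [case: gi|apply: reach_edge; exists g].
have clE i j : pairs_of (root_closure K) i j <-> hull N U i j.
  split=> [[g gi Kg]|].
    by apply/HE; exists g => //; apply: smallest_sub Kg.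
  apply: (hull_sub_closed N_gt0 U_lt U_res).
    by apply/root_closedP; exact: root_closure_closed.
  by move=> x y [g gx Kg]; exists g => //; apply: sub_gen_smallest.
apply/root_coclosedP => i k a b c d C /clE h.
have := hull_coclosed N_gt0 U_lt U_res U_shift Kco C h.
by rewrite !clE.
Qed.

End Roots.

(** * The lattice of biclosed sets *)

Section BiclosedLattice.
Variables (R : realType) (n : nat).
Hypothesis n_gt0 : (0 < n)%N.
Implicit Types (K : set (@Phip R n)) (X : set (biclosed_set R n)).

(** Complementation exchanges the coclosed subsets of [K] with the closed sets containing its
    complement. *)
Lemma root_interiorE K : root_interior K = ~` root_closure (~` K).
Proof.
apply/seteqP; split=> [g [M [Mco MK] Mg] cl|g ncl].
  exact: (cl (~` M) (conj Mco (subsetC MK)) Mg).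
exists (~` root_closure (~` K)) => //; split.
  by rewrite /root_coclosed setCK; exact: root_closure_closed.
by move=> x; apply: contraPP => nKx; apply; apply: sub_gen_smallest.
Qed.

Lemma biclosed_closure_bigcup X : biclosed (root_closure (\bigcup_(J in X) val J)).
Proof.
split; first exact: root_closure_closed.
apply: root_closure_coclosed => // a b g na nb gab [J XJ Jg].
have [_ Jco] := set_mem (valP J).
by apply: (Jco a b g _ _ gab Jg) => h; [apply: na|apply: nb]; exists J.
Qed.

Lemma biclosed_interior_bigcap X : biclosed (root_interior (\bigcap_(J in X) val J)).
Proof.
rewrite root_interiorE; split; last first.
  by rewrite /root_coclosed setCK; exact: root_closure_closed.
apply: root_closure_coclosed => //; rewrite /root_coclosed setCK => a b g ha hb gab J XJ.
have [Jcl _] := set_mem (valP J).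
by apply: (Jcl a b g (ha J XJ) (hb J XJ) gab).
Qed.

Definition biclosed_join X : biclosed_set R n :=
  SigSub (mem_set (biclosed_closure_bigcup X) : _ \in [set J | biclosed J]).

Definition biclosed_meet X : biclosed_set R n :=
  SigSub (mem_set (biclosed_interior_bigcap X) : _ \in [set J | biclosed J]).

Lemma biclosed_leE (A B : biclosed_set R n) : (A <= B)%O = `[< val A `<=` val B >].
Proof. by []. Qed.

Lemma supremums_biclosed_join X : supremums X (biclosed_join X).
Proof.
split=> [J XJ|B ub]; rewrite biclosed_leE; apply/asboolP.
  by move=> g Jg; apply: sub_gen_smallest; exists J.
apply: smallest_sub; first by have [] := set_mem (valP B).
by move=> g [J XJ Jg]; have := ub J XJ; rewrite biclosed_leE => /asboolP; apply.
Qed.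

Lemma infimums_biclosed_meet X : infimums X (biclosed_meet X).
Proof.
split=> [J XJ|B lb]; rewrite biclosed_leE; apply/asboolP.
  by move=> g [M [_ MX] Mg]; exact: (MX _ Mg J XJ).
move=> g Bg; exists (val B) => //; split; first by have [] := set_mem (valP B).
by move=> x Bx J XJ; have := lb J XJ; rewrite biclosed_leE => /asboolP; apply.
Qed.

End BiclosedLattice.

Theorem theorem2p2 (R : realType) (n : nat) (n_ge1 : (1 <= n)%N) :
  complete_lattice (biclosed_set R n) /\
  forall X : set (biclosed_set R n),
    (forall S : biclosed_set R n, supremums X S ->
       val S = root_closure (\bigcup_(J in X) val J)) /\
    (forall I : biclosed_set R n, infimums X I ->
       val I = root_interior (\bigcap_(J in X) val J)).
Proof.
split=> [X|X].
  split; first by exists (biclosed_join n_ge1 X); exact: supremums_biclosed_join.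
  by exists (biclosed_meet n_ge1 X); exact: infimums_biclosed_meet.
split=> [S hS|I hI].
  (* A supremum in a partial order is unique, so [S] is the join constructed above. *)
  by have -> := is_subset1_supremums hS (supremums_biclosed_join n_ge1 X).
by have -> := is_subset1_infimums hI (infimums_biclosed_meet n_ge1 X).
Qed.
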